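(* Let $\beta>0$ and let $G$ be a weakly $(n,\beta)$-graph on $n$ vertices. Then $$\alpha'(G)\ge \min\left\{\frac{1-\beta}{1+\beta},\ \frac{1}{2}\right\}\cdot (n-1).$$ In particular, if $n$ is even and $0<\beta\le 1/3$, then $G$ has a perfect matching.
   Context: All graphs are finite, simple and nonempty. $\alpha'(G)$ denotes the matching number (maximum size of a matching). For vertex sets $X,Y$, $e(X,Y)$ is the number of edges with one end in $X$ and the other in $Y$ (edges with both ends in $X\cap Y$ counted twice). For $\beta>0$, a graph $G$ on $n$ vertices is a weakly $(n,\beta)$-graph if $\frac{|X||Y|}{(n-|X|)(n-|Y|)}\le\beta^2$ for every pair of disjoint proper subsets $X,Y$ of $V(G)$ with no edge between $X$ and $Y$. *)

(* Defs.v *)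
From HB Require Import structures.
From mathcomp Require Import all_boot all_order all_algebra.
From mathcomp Require Import reals.

Set Implicit Arguments.
Unset Strict Implicit.
Unset Printing Implicit Defensive.

Import Order.TTheory GRing.Theory Num.Theory.

Record sgraph := SGraph {
  vertex :> finType;
  adj : rel vertex;
  adj_sym : symmetric adj;
  adj_irrefl : irreflexive adj
}.

Definition edges (G : sgraph) : {set {set G}} :=
  [set e | [exists x, exists y, adj x y && (e == [set x; y])]].

Definition is_matching (G : sgraph) (M : {set {set G}}) : bool :=
  (M \subset edges G) && trivIset M.

Definition matching_number (G : sgraph) : nat :=
  \max_(M : {set {set G}} | is_matching M) #|M|.

Definition has_perfect_matching (G : sgraph) : Prop :=
  exists M : {set {set G}}, is_matching M /\ cover M = [set: G].

Definition no_edge_between (G : sgraph) (X Y : {set G}) : Prop :=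
  forall x y : G, x \in X -> y \in Y -> ~~ adj x y.

Local Open Scope ring_scope.

(* X and Y may be empty; properness makes both factors of the denominator
   nonzero. *)
Definition weakly_nbeta_graph (R : realType) (n : nat) (beta : R)
    (G : sgraph) : Prop :=
  #|G| = n /\
  forall X Y : {set G},
    X \proper [set: G] -> Y \proper [set: G] -> [disjoint X & Y] ->
    no_edge_between X Y ->
    (#|X|%:R * #|Y|%:R) / ((n%:R - #|X|%:R) * (n%:R - #|Y|%:R)) <= beta ^+ 2.

(* Main.v *)
(** By the hard half of the Berge-Tutte formula there is a set [S] of [s]
    vertices whose complement splits into at least [s + d] nonempty, pairwise
    non-adjacent parts, where [d = n - 2 alpha'] is the deficiency.  If
    [d >= 2], distribute the parts over two sets [X] and [Y] with at least
    [a = floor ((s + d) / 2)] vertices each; with [t = 2 alpha' - 2 s], the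
    hypothesis on [(X, Y)] gives [4 a + t <= beta (4 a + 3 t + 4 s)], which is
    the claimed bound and is impossible for [beta <= 1/3].

    The Berge-Tutte part is by induction on the vertex set.  A vertex covered by
    all maximum matchings is moved to [S].  If there is no such vertex, then
    "no maximum matching misses both [u] and [v]" is an equivalence relation
    containing adjacency (Gallai's lemma), and its classes are the parts: the
    [d] vertices missed by one maximum matching lie in distinct classes. *)
Require Import Defs.
From mathcomp Require Import all_boot all_order all_algebra.
From mathcomp Require Import reals.
From mathcomp Require Import zify ring lra.

Set Implicit Arguments.
Unset Strict Implicit.
Unset Printing Implicit Defensive.

Import Order.TTheory GRing.Theory Num.Theory.

(** * Families of disjoint sets *)

Lemma trivIset_eq (T : finType) (P : {set {set T}}) (A B : {set T}) (x : T) :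
  trivIset P -> A \in P -> B \in P -> x \in A -> x \in B -> A = B.
Proof.
move=> /trivIsetP tI AP BP xA xB; apply/eqP; apply/negPn/negP => AB.
by move: (tI A B AP BP AB) => /disjointFr/(_ xA); rewrite xB.
Qed.

Lemma leq_card_cover_set0 (T : finType) (P : {set {set T}}) :
  trivIset P -> set0 \notin P -> (#|P| <= #|cover P|)%N.
Proof.
move=> /eqP <- P0; rewrite -sum1_card; apply: leq_sum => A AP.
by rewrite card_gt0; apply: contraNneq P0 => <-.
Qed.

Lemma exists_subset_card (T : finType) (A : {set T}) (k : nat) :
  (k <= #|A|)%N -> exists2 B : {set T}, B \subset A & #|B| = k.
Proof.
move=> kA; exists [set:: take k (enum A)].
  by apply/subsetP => x; rewrite inE => /mem_take; rewrite mem_enum.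
rewrite cardsE; have /card_uniqP -> := take_uniq k (enum_uniq A).
by rewrite size_takel // -cardE.
Qed.

(** * Edges and matchings *)

Section Matchings.
Variable G : sgraph.
Implicit Types (W X S : {set G}) (M N P : {set {set G}}) (e f : {set G}).

Lemma edgeP e :
  reflect (exists x y, adj x y /\ e = [set x; y]) (e \in edges G).
Proof.
rewrite inE; apply: (iffP existsP) => [[x /existsP[y /andP[xy /eqP->]]]|].
  by exists x, y.
by case=> x [y [xy ->]]; exists x; apply/existsP; exists y; rewrite xy eqxx.
Qed.

Lemma card_edge e : e \in edges G -> #|e| = 2.
Proof.
case/edgeP => x [y [xy ->]]; rewrite cards2.
by case: eqVneq xy => // ->; rewrite adj_irrefl.
Qed.

Lemma edge_other_end e x :
  e \in edges G -> x \in e -> exists y, e = [set x; y].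
Proof.
case/edgeP => a [b [_ ->]]; rewrite !inE => /orP[] /eqP ->; first by exists b.
by exists a; rewrite setUC.
Qed.

Lemma card_cover_matching M : is_matching M -> #|cover M| = (2 * #|M|)%N.
Proof.
case/andP=> /subsetP sM /eqP <-; rewrite mulnC -sum_nat_const.
by apply: eq_bigr => e /sM /card_edge.
Qed.

Lemma matchingS M N : N \subset M -> is_matching M -> is_matching N.
Proof.
move=> NM /andP[sM tM]; rewrite /is_matching (subset_trans NM sM).
exact: trivIsetS NM tM.
Qed.

Lemma matchingU1 M e : is_matching M -> e \in edges G ->
  [disjoint e & cover M] -> is_matching (e |: M).
Proof.
move=> /andP[sM tM] eE eM; rewrite /is_matching subUset sub1set eE sM /=.
apply/trivIsetP => A B; rewrite !inE.
have dis C : C \in M -> [disjoint e & C].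
  by move=> CM; apply: disjointWr eM; exact: bigcup_sup.
move=> /orP[/eqP->|AM] /orP[/eqP->|BM]; first by rewrite eqxx.
- by move=> _; exact: dis.
- by move=> _; rewrite disjoint_sym; exact: dis.
- by move/trivIsetP: tM; apply.
Qed.

Lemma edge_notin_matching M e : e \in edges G -> [disjoint e & cover M] ->
  e \notin M.
Proof.
case/edgeP => x [y [_ ->]] dM; apply/negP => eM.
have xe : x \in [set x; y] by rewrite !inE eqxx.
by move: (disjointFr dM xe) => /negP; apply; apply/bigcupP; exists [set x; y].
Qed.

(** * Maximum matchings inside a vertex set, and Gallai's lemma *)

Definition matching_in W M := is_matching M && (cover M \subset W).

(** The matching number of the subgraph induced on [W]; working with subsets lets the induction stay
    inside [G]. *)
Definition matching_number_in W := \max_(M | matching_in W M) #|M|.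

Definition max_matching_in W M :=
  matching_in W M && (#|M| == matching_number_in W).

Lemma matching_in_set0 W : matching_in W set0.
Proof.
rewrite /matching_in /is_matching sub0set /cover big_set0 sub0set !andbT.
by apply/trivIsetP => A B; rewrite inE.
Qed.

Lemma leq_matching_number_in W M :
  matching_in W M -> (#|M| <= matching_number_in W)%N.
Proof. exact: (@leq_bigmax_cond _ (matching_in W) (fun M => #|M|)). Qed.

Lemma exists_max_matching_in W : exists M, max_matching_in W M.
Proof.
have [|M MW eqM] := @eq_bigmax_cond _ (matching_in W) (fun M => #|M|).
  by apply/card_gt0P; exists set0; exact: matching_in_set0.
exists M; rewrite /max_matching_in [matching_in W M]MW /=.
by rewrite /matching_number_in eqM.
Qed.

Lemma card_cover_max_matching_in W M :
  max_matching_in W M -> #|cover M| = (2 * matching_number_in W)%N.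
Proof. by case/andP => /andP[mM _] /eqP <-; exact: card_cover_matching. Qed.

Lemma max_matching_no_augment W M e : max_matching_in W M ->
  e \in edges G -> e \subset W -> ~~ [disjoint e & cover M].
Proof.
move=> /andP[/andP[mM MW] /eqP cM] eE eW; apply/negP => dM.
have : matching_in W (e |: M).
  by rewrite /matching_in matchingU1 //= /cover bigcup_setU big_set1 subUset eW.
move/leq_matching_number_in; rewrite cardsU1 edge_notin_matching // cM.
by rewrite ltnn.
Qed.

(* Any maximum matching [N] missing [t] can be brought closer to [M]: by
   counting, [M] covers some [x <> t] missed by [N], and the edge of [M] at [x] can
   replace an edge of [N]. *)
Lemma gallai_exchange W M (u v t : G) :
  max_matching_in W M -> u != v -> u \notin cover M -> v \notin cover M ->
  t \in cover M ->
  (exists N, max_matching_in W N /\ t \notin cover N) ->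
  ~ (forall N, max_matching_in W N -> t \notin cover N ->
       u \in cover N /\ v \in cover N).
Proof.
move=> maxM uv uM vM tM [N0 [maxN0 tN0]] miss_t.
pose Q N := max_matching_in W N && (t \notin cover N).
have QN0 : Q N0 by rewrite /Q maxN0.
case: (@arg_maxnP _ N0 Q (fun N => #|M :&: N|) QN0) => N /andP[maxN tN] bestN.
have [uN vN] := miss_t _ maxN tN.
have [x [xM xN xt]] : exists x, [/\ x \in cover M, x \notin cover N & x != t].
  (* The covers of [M] and [N] have equal size, hence so do their two differences. One contains [u]
     and [v], so the other has a vertex besides [t]. *)
  have : (2 <= #|cover N :\: cover M|)%N.
    have <- : #|[set u; v]| = 2 by rewrite cards2 uv.
    by apply: subset_leq_card; apply/subsetP => z; rewrite !inE =>
      /orP[] /eqP ->; rewrite ?uN ?vN ?uM ?vM.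
  have eqD : #|cover N :\: cover M| = #|cover M :\: cover N|.
    rewrite !cardsD (card_cover_max_matching_in maxM).
    by rewrite (card_cover_max_matching_in maxN) setIC.
  rewrite eqD (cardsD1 t) !inE tM tN /= => c.
  have /card_gt0P[x] : (0 < #|(cover M :\: cover N) :\ t|)%N.
    by rewrite -(ltn_add2l 1).
  by rewrite !inE => /and3P[xt xN xM]; exists x.
have /andP[/andP[mM MW] _] := maxM.
have /andP[sM trM] := mM.
have /andP[/andP[mN NW] cN] := maxN.
have /andP[sN trN] := mN.
have /bigcupP[e eM xe] := xM.
have eE : e \in edges G by exact: (subsetP sM).
have eW : e \subset W by apply: subset_trans MW; exact: bigcup_sup.
have [y def_e] := edge_other_end eE xe.
(* If [N] missed [y] as well as [x], adding [e] would enlarge it. *)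
have yN : y \in cover N.
  have /pred0Pn[z /andP[/= ze zN]] := max_matching_no_augment maxN eE eW.
  move: ze; rewrite def_e !inE => /orP[] /eqP zz; last by rewrite -zz.
  by rewrite zz (negPf xN) in zN.
have /bigcupP[f fN yf] := yN.
have ye : y \in e by rewrite def_e !inE eqxx orbT.
have eN : e \notin N.
  by apply: contra xN => eN; apply/bigcupP; exists e.
have fM : f \notin M.
  apply: contra eN => fM.
  by rewrite (trivIset_eq trM eM fM ye yf).
pose N' := e |: (N :\ f).
have dis : [disjoint e & cover (N :\ f)].
  apply/pred0P => z /=; apply/negP => /andP[ze /bigcupP[g]].
  rewrite !inE => /andP[gf gN] zg.
  move: ze; rewrite def_e !inE => /orP[] /eqP zz; subst z.
    by case/negP: xN; apply/bigcupP; exists g.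
  by rewrite (trivIset_eq trN gN fN zg yf) eqxx in gf.
have subNf : cover (N :\ f) \subset cover N.
  apply/subsetP => z /bigcupP[g]; rewrite !inE => /andP[_ gN] zg.
  by apply/bigcupP; exists g.
(* The swap keeps the size, and [t] stays missed: it is neither [x] nor the covered vertex [y]. *)
have QN' : Q N'.
  rewrite /Q /max_matching_in /matching_in.
  rewrite matchingU1 ?(matchingS (subsetDl _ _) mN) //=.
  rewrite /cover bigcup_setU big_set1 subUset eW (subset_trans subNf NW) /=.
  rewrite cardsU1 edge_notin_matching //= -(eqP cN) (cardsD1 f N) fN eqxx /=.
  rewrite inE negb_or [_ \notin cover _](contra (subsetP subNf t) tN) andbT.
  rewrite def_e !inE negb_or eq_sym xt /=.
  by apply: contraNneq tN => ->.
have := bestN _ QN'; rewrite /= leqNgt => /negP; apply.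
apply: (@leq_trans #|e |: (M :&: N)|).
  by rewrite cardsU1 inE eM (negPf eN).
apply: subset_leq_card; apply/subsetP => g; rewrite !inE.
case/orP => [/eqP ->|/andP[gM gN]]; first by rewrite eM eqxx.
rewrite gM gN andbT /=; apply/orP; right.
by apply: contraNneq fM => <-.
Qed.

(** The disjunct [u == v] supplies reflexivity: a vertex missed by some maximum matching fails the
    second clause against itself. *)
Definition never_both_missed W (u v : G) :=
  (u == v) ||
  [forall M, max_matching_in W M ==> (u \in cover M) || (v \in cover M)].

Lemma never_both_missedP W u v : reflect
  (u = v \/ forall M, max_matching_in W M -> u \notin cover M -> v \in cover M)
  (never_both_missed W u v).
Proof.
apply: (iffP orP) => -[/eqP|]; try by move=> ->; left.
- move=> /forallP h; right => M maxM uM.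
  by move: (h M); rewrite maxM (negPf uM).
- move=> h; right; apply/forallP => M; apply/implyP => maxM.
  by case: (boolP (u \in cover M)) => //= uM; exact: h.
Qed.

Lemma never_both_missed_sym W : symmetric (never_both_missed W).
Proof.
move=> u v; rewrite /never_both_missed eq_sym; congr (_ || _).
by apply: eq_forallb => M; rewrite orbC.
Qed.

(** A maximum matching missing [u] and [v] would cover [t], while every one missing [t] covers both;
    [gallai_exchange] excludes this. *)
Lemma never_both_missed_trans W (u t v : G) :
  (exists N, max_matching_in W N /\ t \notin cover N) ->
  never_both_missed W u t -> never_both_missed W t v ->
  never_both_missed W u v.
Proof.
move=> Nt ut tv.
have [->|uv] := eqVneq u v; first by rewrite /never_both_missed eqxx.
case/never_both_missedP: (ut) => [->//|Hut].
case/never_both_missedP: (tv) => [<-//|Htv].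
rewrite never_both_missed_sym in ut.
case/never_both_missedP: ut => [<-//|Htu].
apply/never_both_missedP; right => M maxM uM; apply/negPn/negP => vM.
apply: (gallai_exchange maxM uv uM vM (Hut _ maxM uM) Nt) => N maxN tN.
by split; [exact: Htu | exact: Htv].
Qed.

(** An edge inside [W] with both ends missed would augment the matching. *)
Lemma adj_never_both_missed W x y :
  x \in W -> y \in W -> adj x y -> never_both_missed W x y.
Proof.
move=> xW yW xy; apply/never_both_missedP; right => M maxM xM.
have eE : [set x; y] \in edges G by apply/edgeP; exists x, y.
have eW : [set x; y] \subset W by rewrite subUset !sub1set xW.
have /pred0Pn[z /andP[/=]] := max_matching_no_augment maxM eE eW.
by rewrite !inE => /orP[] /eqP -> //; rewrite (negPf xM).
Qed.

Definition pairwise_nonadjacent P :=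
  forall A B, A \in P -> B \in P -> A != B -> no_edge_between A B.

Lemma gallai_partition W :
  (forall v, v \in W -> exists N, max_matching_in W N /\ v \notin cover N) ->
  exists P, [/\ partition P W, pairwise_nonadjacent P
    & (#|W| <= 2 * matching_number_in W + #|P|)%N].
Proof.
move=> allmiss; pose R := never_both_missed W.
have eqR : {in W & &, equivalence_rel R}.
  move=> x y z xW yW zW; split; first by rewrite /R /never_both_missed eqxx.
  move=> xy; apply/idP/idP => h.
    apply: never_both_missed_trans h; first exact: allmiss.
    by rewrite never_both_missed_sym.
  by apply: never_both_missed_trans xy h; exact: allmiss.
have partP := equivalence_partitionP eqR.
exists (equivalence_partition R W); split=> //.
  move=> A B AP BP AB x y xA yB; apply/negP => xy.
  have /and3P[/eqP covP trP _] := partP.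
  have xW : x \in W by rewrite -covP; apply/bigcupP; exists A.
  have yW : y \in W by rewrite -covP; apply/bigcupP; exists B.
  have := adj_never_both_missed xW yW xy.
  rewrite -/(R x y) -(pblock_equivalence_partition eqR) //.
  rewrite (def_pblock trP AP xA) => yA; case/negP: AB.
  by apply/eqP; exact: (trivIset_eq trP AP BP yA yB).
have [M maxM] := exists_max_matching_in W.
rewrite -(card_cover_max_matching_in maxM).
have /andP[/andP[_ MW] _] := maxM.
have := cardsID (cover M) W; rewrite (setIidPr MW) => <-.
rewrite leq_add2l.
have /and3P[/eqP covP trP _] := partP.
(* Distinct vertices of one class are never both missed, so [pblock] is injective on the vertices of
   [W] missed by [M]. *)
have <- : #|pblock (equivalence_partition R W) @: (W :\: cover M)|
       = #|W :\: cover M|.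
  apply: card_in_imset => x y; rewrite !inE => /andP[xM xW] /andP[yM yW] eqb.
  have : R x y.
    rewrite -(pblock_equivalence_partition eqR) // eqb mem_pblock.
    by rewrite covP.
  by case/never_both_missedP => // /(_ _ maxM xM); rewrite (negPf yM).
apply: subset_leq_card; apply/subsetP => _ /imsetP[x + ->].
by rewrite !inE => /andP[_ xW]; apply: pblock_mem; rewrite covP.
Qed.

(** * The Berge-Tutte bound and the resulting pair of sets *)

Lemma berge_partition W :
  exists S P, [/\ partition P (W :\: S), pairwise_nonadjacent P, S \subset W
    & (#|W| + #|S| <= 2 * matching_number_in W + #|P|)%N].
Proof.
have [m] := ubnP #|W|; elim: m W => // m IHm W ltm.
case: (boolP [exists v in W,
    [forall M, max_matching_in W M ==> (v \in cover M)]]); last first.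
  rewrite negb_exists => /forallP noess.
  have [|P [partP nadjP cP]] := @gallai_partition W.
    move=> v vW; have := noess v; rewrite vW /= negb_forall => /existsP[N].
    by rewrite negb_imply => /andP[maxN vN]; exists N.
  by exists set0, P; rewrite setD0 cards0 addn0 sub0set.
case/existsP => v /andP[vW /forallP ess].
have cW := cardsD1 v W; rewrite vW in cW.
have [|S [P [partP nadjP SW cP]]] := IHm (W :\ v); first by lia.
have vS : v \notin S by apply/negP => /(subsetP SW); rewrite !inE eqxx.
exists (v |: S), P; split=> //.
- by rewrite setUC setDUr setDDl setUC -setDUr in partP *.
- by rewrite subUset sub1set vW (subset_trans SW (subsetDl _ _)).
(* Every maximum matching in [W] covers [v], so deleting [v] costs an edge; this pays for the
   increase of [#|W| + #|S|] by 2. *)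
- have lt_nu : (matching_number_in (W :\ v) < matching_number_in W)%N.
    have [M /andP[/andP[mM MWv] /eqP cM]] := exists_max_matching_in (W :\ v).
    have MW : matching_in W M.
      by rewrite /matching_in mM (subset_trans MWv (subsetDl _ _)).
    rewrite -cM ltn_neqAle leq_matching_number_in // andbT.
    apply/negP => eqM; have := ess M; rewrite /max_matching_in MW eqM /=.
    by move/(subsetP MWv); rewrite !inE eqxx.
  by rewrite cardsU1 vS; lia.
Qed.

Lemma matching_number_inT : matching_number_in setT = matching_number G.
Proof. by apply: eq_bigl => M; rewrite /matching_in subsetT andbT. Qed.

Lemma double_matching_number_le : (2 * matching_number G <= #|G|)%N.
Proof.
have [M maxM] := exists_max_matching_in setT.
by rewrite -matching_number_inT -(card_cover_max_matching_in maxM) max_card.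
Qed.

Lemma double_matching_number_perfect :
  (2 * matching_number G)%N = #|G| -> has_perfect_matching G.
Proof.
move=> eqG; have [M maxM] := exists_max_matching_in setT.
have cM := card_cover_max_matching_in maxM.
have /andP[/andP[mM _] _] := maxM; exists M; split=> //.
apply/eqP; rewrite eqEcard subsetT cM matching_number_inT eqG.
by rewrite cardsT leqnn.
Qed.

Lemma cover_no_edge_between P (Q1 Q2 : {set {set G}}) :
  trivIset P -> pairwise_nonadjacent P ->
  Q1 \subset P -> Q2 \subset P -> [disjoint Q1 & Q2] ->
  [disjoint cover Q1 & cover Q2] /\ no_edge_between (cover Q1) (cover Q2).
Proof.
move=> trP nadj s1 s2 d12; split.
  apply/pred0P => z /=; apply/negP.
  move=> /andP[/bigcupP[A A1 zA] /bigcupP[B B2 zB]].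
  have eqAB := trivIset_eq trP (subsetP s1 _ A1) (subsetP s2 _ B2) zA zB.
  by rewrite eqAB in A1; rewrite (disjointFr d12 A1) in B2.
move=> x y /bigcupP[A A1 xA] /bigcupP[B B2 yB].
apply: (nadj A B) => //; [exact: (subsetP s1)|exact: (subsetP s2)|].
by apply: contraTneq A1 => ->; rewrite (disjointFl d12 B2).
Qed.

Lemma deficient_split : (2 * matching_number G + 2 <= #|G|)%N ->
  exists (X Y : {set G}) (s a t : nat),
  [/\ X \proper [set: G], Y \proper [set: G], [disjoint X & Y],
      no_edge_between X Y
    & [/\ (a <= #|X|)%N, (a <= #|Y|)%N, (#|X| + #|Y| + s = #|G|)%N,
      (s < 2 * a)%N
    & (2 * matching_number G = t + 2 * s /\
       2 * a + t + s <= #|G| <= (2 * a + t + s).+1)%N]].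
Proof.
move=> def2; have [S [P [partP nadj _ cP]]] := berge_partition setT.
rewrite matching_number_inT cardsT setTD in cP partP.
have /and3P[/eqP covP trP P0] := partP.
have leP := leq_card_cover_set0 trP P0; rewrite covP in leP.
have cS := cardsC S.
set nu := matching_number G in def2 cP *.
(* Half the guaranteed number of parts. Rounding down loses at most one vertex in [2 * a + t + s],
   whence the [.+1] in the conclusion. *)
pose a := (#|S| + (#|G| - 2 * nu))./2.
have [Q QP cQ] : exists2 Q : {set {set G}}, Q \subset P & #|Q| = a.
  by apply: exists_subset_card; rewrite /a; lia.
have [dXY nXY] :
    [disjoint cover Q & cover (P :\: Q)] /\
    no_edge_between (cover Q) (cover (P :\: Q)).
  apply: (cover_no_edge_between trP nadj) => //; first exact: subsetDl.
  by rewrite -setI_eq0 setDE setICA setICr setI0.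
have aX : (a <= #|cover Q|)%N.
  rewrite -cQ; apply: leq_card_cover_set0; first exact: trivIsetS QP trP.
  by apply: contra P0; apply: (subsetP QP).
have aY : (a <= #|cover (P :\: Q)|)%N.
  apply: leq_trans (_ : #|P :\: Q| <= _)%N.
    by rewrite cardsD (setIidPr QP) cQ /a; lia.
  apply: leq_card_cover_set0; first exact: trivIsetS (subsetDl _ _) trP.
  by apply: contra P0; rewrite inE => /andP[].
have cXY : (#|cover Q| + #|cover (P :\: Q)| + #|S| = #|G|)%N.
  rewrite -cS addnC; congr (_ + _)%N.
  move: dXY; rewrite -leq_card_setU => /eqP <-.
  rewrite /cover -bigcup_setU setDE setUIr setUCr setIT (setUidPr QP).
  by rewrite -/(cover P) covP.
(* Deficiency at least 2 absorbs the rounding in [a]. *)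
have sa : (#|S| < 2 * a)%N by rewrite /a; lia.
(* The subtraction is not truncated: [P] has at most [#|G| - #|S|] parts, so [cP] forces
   [#|S| <= nu]. *)
exists (cover Q), (cover (P :\: Q)), #|S|, a, (2 * nu - 2 * #|S|)%N.
split=> //; [by rewrite properEcard subsetT cardsT; lia..|].
by split=> //; rewrite /a in aX aY sa *; lia.
Qed.

End Matchings.

(** * Real inequalities *)

Local Open Scope ring_scope.

(** The right side is nondecreasing in [x] and in [y], and for a fixed sum it is nondecreasing in
    [x * y]; hence it is least at the most unbalanced pair [(a, a + t)]. *)
Lemma ratio_balance (R : realFieldType) (x y a s t : R) :
  0 < a -> 0 <= s -> 0 <= t -> a <= x -> a <= y -> 2 * a + t <= x + y ->
  a * (a + t) / ((a + s) * (a + t + s)) <= x * y / ((x + s) * (y + s)).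
Proof.
move=> a0 s0 t0 ax ay xy.
rewrite ler_pdivrMr; last by apply: mulr_gt0; lra.
rewrite mulrAC ler_pdivlMr; last by apply: mulr_gt0; lra.
have h1 : 0 <= (x - a) * (y - a) by apply: mulr_ge0; lra.
have h2 : 0 <= (x + y - (2 * a + t)) * (a + s) by apply: mulr_ge0; lra.
have h3 : 0 <= (x - a) * (y - a) * (s * (2 * a + t + s)).
  by apply: mulr_ge0 => //; apply: mulr_ge0; lra.
have h4 : 0 <= (a * s) * ((x + y - (2 * a + t)) * (a + s)).
  by apply: mulr_ge0 => //; apply: mulr_ge0; lra.
rewrite -subr_ge0 (_ : _ - _ = (x - a) * (y - a) * (s * (2 * a + t + s)) +
   (a * s) * ((x + y - (2 * a + t)) * (a + s))); last by ring.
exact: addr_ge0.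
Qed.

(** With [N = 2 * a + t + s] and [nu = t / 2 + s], the squared ratio is [(N - nu) / (N + nu)], the
    value of [beta] for which [(1 - beta) / (1 + beta) * N = nu]. Equality holds at [t = 0]. *)
Lemma sqr_ratio_le (R : realFieldType) (a s t : R) :
  0 < a -> 0 <= s -> 0 <= t -> s <= 2 * a ->
  ((4 * a + t) / (4 * a + 3 * t + 4 * s)) ^+ 2
    <= a * (a + t) / ((a + s) * (a + t + s)).
Proof.
move=> a0 s0 t0 sa.
rewrite expr_div_n ler_pdivrMr; last by apply: exprn_gt0; lra.
rewrite mulrAC ler_pdivlMr; last by apply: mulr_gt0; lra.
(* Since [b <= 3 * a], the difference of the cross-multiplied sides is a polynomial in [t] with
   nonnegative coefficients. *)
pose b := a + s.
have b0 : 0 < b by rewrite /b; lra.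
have h1 : 0 <= t * (8 * a * b * (a + b)).
  by rewrite !mulr_ge0 //; lra.
have h2 : 0 <= t ^+ 2 * (9 * a ^+ 2 + b * (16 * a - b)).
  apply: mulr_ge0; first exact: sqr_ge0.
  by apply: addr_ge0; rewrite mulr_ge0 ?sqr_ge0 //; rewrite /b; lra.
have h3 : 0 <= t ^+ 3 * (9 * a - b).
  by apply: mulr_ge0; [exact: exprn_ge0|rewrite /b; lra].
rewrite -subr_ge0 (_ : _ - _ = t * (8 * a * b * (a + b)) +
  t ^+ 2 * (9 * a ^+ 2 + b * (16 * a - b)) + t ^+ 3 * (9 * a - b)).
  by rewrite !addr_ge0.
by rewrite /b; ring.
Qed.

(** * The bound on the matching number *)

Lemma deficient_beta_ge (R : realType) (beta : R) (G : sgraph) :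
  0 < beta -> weakly_nbeta_graph #|G| beta G ->
  (2 * matching_number G + 2 <= #|G|)%N ->
  exists s a t : nat, [/\ (s < 2 * a)%N,
    (2 * matching_number G = t + 2 * s)%N, (#|G| <= (2 * a + t + s).+1)%N
    & 4 * a%:R + t%:R <= beta * (4 * a%:R + 3 * t%:R + 4 * s%:R)].
Proof.
move=> b0 [_ HG] def2.
have [X [Y [s [a [t [pX pY dXY nXY [aX aY cXY sa [eqt /andP[lo hi]]]]]]]]] :=
  deficient_split def2.
exists s, a, t; split=> //.
have := HG X Y pX pY dXY nXY.
have := congr1 (fun k => k%:R : R) cXY; rewrite /= !natrD => <-.
have xR : a%:R <= #|X|%:R :> R by rewrite ler_nat.
have yR : a%:R <= #|Y|%:R :> R by rewrite ler_nat.
have xyR : 2 * a%:R + t%:R <= #|X|%:R + #|Y|%:R :> R.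
  by rewrite -natrM -!natrD ler_nat; lia.
have a0 : 0 < a%:R :> R by rewrite ltr0n; lia.
have s0 : 0 <= s%:R :> R by [].
have t0 : 0 <= t%:R :> R by [].
have saR : s%:R <= 2 * a%:R :> R by rewrite -natrM ler_nat ltnW.
move: {cXY aX aY pX pY dXY nXY HG} (#|X|%:R : R) (#|Y|%:R : R) xR yR xyR =>
  x y xR yR xyR.
rewrite (_ : (_ - x) * (_ - y) = (x + s%:R) * (y + s%:R)); last by ring.
move=> H.
have := le_trans (sqr_ratio_le a0 s0 t0 saR)
  (le_trans (ratio_balance a0 s0 t0 xR yR xyR) H).
rewrite ler_pXn2r // ?nnegrE; [|apply: divr_ge0; lra|exact: ltW].
by rewrite ler_pdivrMr //; lra.
Qed.

Theorem theorem3p3 (R : realType) (n : nat) (beta : R) (G : sgraph)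
    (n_gt0 : (0 < n)%N) (beta_gt0 : 0 < beta)
    (HG : weakly_nbeta_graph n beta G) :
  Num.min ((1 - beta) / (1 + beta)) (1 / 2) * (n%:R - 1)
    <= (matching_number G)%:R
  /\ (~~ odd n -> beta <= 1 / 3 -> has_perfect_matching G).
Proof.
have cG : #|G| = n by case: HG.
subst n.
have le2 := double_matching_number_le G.
have n1 : 0 <= #|G|%:R - 1 :> R by rewrite subr_ge0 ler1n.
set nu := matching_number G in le2 *.
(* Deficiency at most 1 gives the bound with factor [1 / 2], and for even order it must be 0. *)
have [def2|] := leqP (2 * nu + 2) #|G|; last first.
  move=> def1; split; last first.
    by move=> evenG _; apply: double_matching_number_perfect; rewrite -/nu; lia.
  apply: (@le_trans _ _ (1 / 2 * (#|G|%:R - 1))).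
    by rewrite ler_wpM2r // ge_min lexx orbT.
  have : #|G|%:R <= 2 * nu%:R + 1 :> R by rewrite -natrM natr1 ler_nat; lia.
  by lra.
have [s [a [t [sa eqnu hi Hb]]]] := deficient_beta_ge beta_gt0 HG def2.
have eqR : 2 * nu%:R = t%:R + 2 * s%:R :> R by rewrite -!natrM -natrD eqnu.
have hiR : #|G|%:R <= 2 * a%:R + t%:R + s%:R + 1 :> R.
  by rewrite -natrM -!natrD natr1 ler_nat.
have saR : s%:R < 2 * a%:R :> R by rewrite -natrM ltr_nat.
have s0 : 0 <= s%:R :> R by [].
have t0 : 0 <= t%:R :> R by [].
split; last first.
  move=> _ b3.
  (* Then [Hb] would give [8 * a <= 4 * s], against [s < 2 * a]; so deficiency at least 2 cannot
     occur here. *)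
  have : beta * (4 * a%:R + 3 * t%:R + 4 * s%:R) <=
    1 / 3 * (4 * a%:R + 3 * t%:R + 4 * s%:R) by rewrite ler_wpM2r //; lra.
  by lra.
apply: (@le_trans _ _ ((1 - beta) / (1 + beta) * (#|G|%:R - 1))).
  by rewrite ler_wpM2r // ge_min lexx.
have b1 : 0 < 1 + beta by lra.
rewrite mulrAC ler_pdivrMr //.
have [b_le1|b_gt1] := leP beta 1.
  (* Once [#|G| - 1] is replaced by [2 * a + t + s], the goal is a rearrangement of [Hb]. *)
  have : (1 - beta) * (#|G|%:R - 1) <=
      (1 - beta) * (2 * a%:R + t%:R + s%:R) by rewrite ler_wpM2l //; lra.
  have -> : nu%:R = (t%:R + 2 * s%:R) / 2 :> R by lra.
  by lra.
(* For [beta > 1] the left-hand side is at most 0. *)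
apply: (@le_trans _ _ 0); last by rewrite mulr_ge0 // ltW.
by rewrite nmulr_rle0 //; lra.
Qed.
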